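(* Consider a diffusion model on $\mathbb{R}^d$ with drift coefficient $\alpha(\tau)$, diffusion coefficient $\beta(\tau)$, $\tau\in[0,T]$, and target data distribution $p_0$. Let $p_\tau$ be its marginal density at time $\tau$, and put $$\bar\alpha_\tau=\exp\Big(-\int_0^\tau\alpha(s)\,\mathrm{d}s\Big),\qquad \sigma_\tau^2=\int_0^\tau \exp\Big(-2\int_s^\tau\alpha(r)\,\mathrm{d}r\Big)\beta(s)\,\mathrm{d}s,\quad \sigma_\tau\ge 0.$$ Consider also the Gaussian flow-matching model with base distribution $q_0=\mathcal{N}(\mathbf{0},\mathbf{I})$, target distribution $q_1$ and optimal velocity field $\boldsymbol{v}^*(\cdot,t)$. Suppose the two models target the same distribution, i.e. $q_1=p_0$. Then, for $\tau\in(0,T]$ and $$t=\frac{1}{1+\sigma_\tau/\bar\alpha_\tau},$$ the velocity field and the score function satisfy, for every $\boldsymbol{x}\in\mathbb{R}^d$, $$(1-t)\,\boldsymbol{v}^*(\boldsymbol{x},t)=\frac{\sigma_\tau}{\bar\alpha_\tau}\Big[\boldsymbol{x}+\sigma_\tau\,(\nabla\log p_\tau)\big((\bar\alpha_\tau+\sigma_\tau)\boldsymbol{x}\big)\Big].$$ Moreover, this transformation is bijective: $\sigma_\tau/\bar\alpha_\tau$ increases strictly with $\tau$, which ensures a one-to-one correspondence between $\tau$ and $t$.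
   Context: Diffusion model: the forward process is the SDE $\mathrm{d}\boldsymbol{x}_\tau=-\alpha(\tau)\boldsymbol{x}_\tau\,\mathrm{d}\tau+\sqrt{\beta(\tau)}\,\mathrm{d}\boldsymbol{w}$ on $\mathbb{R}^d$ with $\boldsymbol{x}_0\sim p_0$ and $\boldsymbol{w}$ a Wiener process (independent of $\boldsymbol{x}_0$). Its conditional law is $\boldsymbol{x}_\tau\mid\boldsymbol{x}_0\sim\mathcal{N}(\bar\alpha_\tau\boldsymbol{x}_0,\sigma_\tau^2\mathbf{I})$, with $\bar\alpha_\tau,\sigma_\tau$ as in the claim, so the marginal density is $p_\tau(\boldsymbol{y})=\int\mathcal{N}(\boldsymbol{y};\bar\alpha_\tau\boldsymbol{x}_0,\sigma_\tau^2\mathbf{I})\,p_0(\mathrm{d}\boldsymbol{x}_0)$, where $\mathcal{N}(\boldsymbol{y};\boldsymbol{m},\Sigma)$ is the Gaussian density at $\boldsymbol{y}$ with mean $\boldsymbol{m}$ and covariance $\Sigma$. The score function is $\nabla\log p_\tau:\mathbb{R}^d\to\mathbb{R}^d$; $(\nabla\log p_\tau)(\boldsymbol{y})$ means this gradient evaluated at the point $\boldsymbol{y}$ (no chain-rule factor from the scaling). Flow-matching model: $\boldsymbol{x}_0\sim q_0=\mathcal{N}(\mathbf{0},\mathbf{I})$ and $\boldsymbol{x}_1\sim q_1$ are independent, and $\boldsymbol{x}_t=(1-t)\boldsymbol{x}_0+t\boldsymbol{x}_1$ for $t\in[0,1]$. (Indices $0,1,t$ here refer to flow time and are unrelated to diffusion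 time $\tau$.) The optimal velocity field, i.e. the minimizer over $\boldsymbol{v}$ of $\mathbb{E}_{t,\boldsymbol{x}_0,\boldsymbol{x}_1}\|\boldsymbol{v}(\boldsymbol{x}_t,t)-(\boldsymbol{x}_1-\boldsymbol{x}_0)\|^2$, is the conditional expectation $$\boldsymbol{v}^*(\boldsymbol{x},t)=\mathbb{E}\big[\boldsymbol{x}_1-\boldsymbol{x}_0\,\big|\,\boldsymbol{x}_t=\boldsymbol{x}\big].$$ For $t\in(0,1)$ it is evaluated using the conditional law of $\boldsymbol{x}_1$ given $\boldsymbol{x}_t=\boldsymbol{x}$ whose density with respect to $q_1$ is $\boldsymbol{x}_1\mapsto\mathcal{N}(\boldsymbol{x};t\boldsymbol{x}_1,(1-t)^2\mathbf{I})\big/\int\mathcal{N}(\boldsymbol{x};t\boldsymbol{z},(1-t)^2\mathbf{I})\,q_1(\mathrm{d}\boldsymbol{z})$, together with $\boldsymbol{x}_0=(\boldsymbol{x}-t\boldsymbol{x}_1)/(1-t)$.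
   Formalization: The formal statement assumes α and β are integrable on [0,T] and β > 0 almost everywhere; without the latter, σ_τ/ᾱ_τ need not increase strictly (e.g. if β vanishes on an interval). *)

(* Defs.v *)
From HB Require Import structures.
From mathcomp Require Import all_boot all_order all_algebra.
From mathcomp Require Import all_classical all_reals all_analysis.
Import Order.TTheory GRing.Theory Num.Theory.
Import numFieldNormedType.Exports.

Set Implicit Arguments.
Unset Strict Implicit.
Unset Printing Implicit Defensive.

Local Open Scope classical_set_scope.
Local Open Scope ring_scope.

(* 'rV[R]_d carries no canonical sigma-algebra; this alias gives it the Borel
   one, generated by the open sets. *)
Definition borel_rV (R : realType) (d : nat) :=
  g_sigma_algebraType (@open 'rV[R]_d).

Definition mvnormal_pdf (R : realType) (d : nat)
    (m : 'rV[R]_d) (Sigma : 'M[R]_d) (y : 'rV[R]_d) : R :=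
  (Num.sqrt ((2 * pi) ^+ d * \det Sigma))^-1 *
  expR (- (((y - m) *m invmx Sigma *m (y - m)^T) 0 0 / 2)).

(* The vector of partial derivatives; like 'D_v it is total, so statements
   using it should also assert differentiability. *)
Definition gradient (R : realType) (d : nat) (f : 'rV[R]_d -> R)
    (y : 'rV[R]_d) : 'rV[R]_d :=
  \row_i 'D_(delta_mx 0 i) f y.

Section diffusion.
Context {R : realType}.
Local Notation mu := (@lebesgue_measure R).
Variables alpha beta : R -> R.

Definition abar (tau : R) : R :=
  expR (- \int[mu]_(s in `[0, tau]) alpha s).

Definition sigma (tau : R) : R :=
  Num.sqrt (\int[mu]_(s in `[0, tau])
    (expR (- (2 * \int[mu]_(r in `[s, tau]) alpha r)) * beta s)).

Definition noise_ratio (tau : R) : R := sigma tau / abar tau.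

Definition flow_time (tau : R) : R := (1 + noise_ratio tau)^-1.

(* Density at time tau of dx = - alpha x dtau + sqrt beta dw with x_0 ~ p0,
   whose transition law is x_tau | x_0 ~ N(abar x_0, sigma^2 I). *)
Definition diffusion_pdf (d : nat) (p0 : probability (borel_rV R d) R)
    (tau : R) (y : 'rV[R]_d) : R :=
  \int[p0]_(x0 in [set: borel_rV R d])
    mvnormal_pdf (abar tau *: (x0 : 'rV[R]_d)) ((sigma tau ^+ 2)%:M) y.

Definition log_diffusion_pdf (d : nat) (p0 : probability (borel_rV R d) R)
    (tau : R) (y : 'rV[R]_d) : R :=
  ln (diffusion_pdf p0 tau y).

Definition score (d : nat) (p0 : probability (borel_rV R d) R) (tau : R) :
    'rV[R]_d -> 'rV[R]_d :=
  gradient (log_diffusion_pdf p0 tau).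

End diffusion.

(* x_t = (1 - t) x_0 + t x_1 with x_0 ~ N(0, I) and x_1 ~ q1 independent, so
   that x_t | x_1 ~ N(t x_1, (1 - t)^2 I); all of this is for 0 < t < 1. *)
Section flow_matching.
Context {R : realType} {d : nat}.
Variable q1 : probability (borel_rV R d) R.

Definition flow_pdf (t : R) (x : 'rV[R]_d) : R :=
  \int[q1]_(z in [set: borel_rV R d])
    mvnormal_pdf (t *: (z : 'rV[R]_d)) (((1 - t) ^+ 2)%:M) x.

(* Density with respect to q1 of the conditional law of x_1 given x_t = x. *)
Definition flow_posterior (t : R) (x x1 : 'rV[R]_d) : R :=
  mvnormal_pdf (t *: x1) (((1 - t) ^+ 2)%:M) x / flow_pdf t x.

(* The value of x_1 - x_0 once x_t = x and x_1 are known. *)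
Definition flow_displacement (t : R) (x x1 : 'rV[R]_d) : 'rV[R]_d :=
  x1 - (1 - t)^-1 *: (x - t *: x1).

Definition velocity_integrand (t : R) (x : 'rV[R]_d) (i : 'I_d)
    (x1 : borel_rV R d) : R :=
  flow_displacement t x x1 0 i * flow_posterior t x x1.

(* v*(x, t) = E[x_1 - x_0 | x_t = x], the minimizer of the flow-matching
   loss, computed with the conditional density above. *)
Definition velocity (x : 'rV[R]_d) (t : R) : 'rV[R]_d :=
  \row_i \int[q1]_(x1 in [set: borel_rV R d]) velocity_integrand t x i x1.

End flow_matching.

(* Main.v *)
(* With y = (a + s) x and t = a / (a + s), the points x - t z and y - a z are
   proportional, so the flow posterior of x_1 = z and the diffusion posterior
   of x_0 = z are the same density, proportional to exp(-|y - a z|^2 / (2 s^2)).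
   Both the velocity and the score are affine in the mean of y - a z under it.
   The score comes from differentiating the Gaussian mixture under the
   integral: the second-order Taylor remainder of the Gaussian is bounded
   uniformly in the base point, so no domination argument is needed.
   For the monotonicity, (sigma/abar)^2 is the integral over [0, tau] of
   exp(2 \int_0^s alpha) beta(s), whose integrand is positive a.e. *)

Require Import Defs.
From HB Require Import structures.
From mathcomp Require Import all_boot all_order all_algebra.
From mathcomp Require Import all_classical all_reals all_analysis.
From mathcomp Require Import measurable_realfun ring lra.
Import Order.TTheory GRing.Theory Num.Theory.
Import numFieldNormedType.Exports.

Set Implicit Arguments.
Unset Strict Implicit.
Unset Printing Implicit Defensive.

Local Open Scope classical_set_scope.
Local Open Scope ring_scope.

(** * Positivity and additivity of integrals; bijectivity of 1 / (1 + r) *)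

(** As [f] agrees a.e. on [D] with its absolute value, a zero integral would force [f] = 0 a.e. on
    [D]; together with [f] > 0 a.e. this would make [D] null. *)
Lemma Rintegral_gt0 (R : realType) d (T : measurableType d)
    (mu : {measure set T -> \bar R}) (D : set T) (f : T -> R) :
  measurable D -> mu D != 0%E -> mu.-integrable D (EFin \o f) ->
  {ae mu, forall x, D x -> 0 < f x} -> 0 < \int[mu]_(x in D) f x.
Proof.
move=> mD muD fint fgt0.
have [mf _] := elimT (integrableP mu D (EFin \o f)) fint.
have fnorm : (\int[mu]_(x in D) (EFin \o f) x =
              \int[mu]_(x in D) `|(EFin \o f) x|)%E.
  apply: ae_eq_integral => //; first exact: measurableT_comp.
  by apply: filterS fgt0 => x fx Dx /=; rewrite gtr0_norm// fx.
rewrite lt_neqAle; apply/andP; split; last first.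
  by rewrite /Rintegral fnorm fine_ge0// integral_ge0.
apply/eqP => int0.
have : (\int[mu]_(x in D) `|(EFin \o f) x| = 0)%E.
  by rewrite -fnorm -[LHS]fineK ?integrable_fin_num// -[fine _]int0.
move/(ae_eq_integral_abs mu mD mf) => f0.
move/negP: muD; apply; apply/eqP.
suff [N [mN muN DN]] : {ae mu, forall x, ~ D x}.
  apply: subset_measure0 muN => //.
  by move=> x Dx; apply: DN => /=; exact.
apply: filterS2 fgt0 f0 => x fgt0 f0 Dx.
by have := fgt0 Dx; have /= [->] := f0 Dx; rewrite ltxx.
Qed.

Lemma Rintegral_itv0B (R : realType) (f : R -> R) (b x y : R) :
  (@lebesgue_measure R).-integrable `[0, b] (EFin \o f) ->
  0 <= x -> x <= y -> y <= b ->
  \int[@lebesgue_measure R]_(t in `[x, y]) f t =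
  \int[@lebesgue_measure R]_(t in `[0, y]) f t -
  \int[@lebesgue_measure R]_(t in `[0, x]) f t.
Proof.
move=> fint x0 xy yb.
have fint' : (@lebesgue_measure R).-integrable `[0, y] (EFin \o f).
  by apply: integrableS fint => //; apply: subset_itvl; rewrite bnd_simp.
rewrite (Rintegral_itvB fint') ?bnd_simp// Rintegral_itv_obnd_cbnd//.
by apply: integrableS fint' => //; apply: subset_itvr; rewrite bnd_simp.
Qed.

(** The last hypothesis is the form in which the intermediate value theorem is used. As [r 0] = 0,
    the excluded time 0 matches the excluded value 1. *)
Lemma inv1D_set_bij (R : realType) (r : R -> R) (T : R) :
  0 < T -> r 0 = 0 ->
  (forall x y, 0 <= x -> x < y -> y <= T -> r x < r y) ->
  (forall v, 0 <= v <= r T -> exists2 c, 0 <= c <= T & r c = v) ->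
  set_bij `]0, T] `[(1 + r T)^-1, 1[ (fun x => (1 + r x)^-1).
Proof.
move=> T0 r0 incr surj.
have rgt0 x : 0 < x -> x <= T -> 0 < r x by move=> x0 xT; rewrite -r0 incr.
have ler x : 0 < x -> x <= T -> r x <= r T.
  move=> x0; rewrite le_eqVlt => /predU1P[->//|xT].
  by rewrite ltW// incr// ltW.
split.
- move=> x /=; rewrite !in_itv/= => /andP[x0 xT].
  have rx := rgt0 x x0 xT; have rxT := ler x x0 xT.
  rewrite lef_pV2 ?posrE ?invf_lt1 ?ltrDl ?lerD2l ?rxT ?rx// addr_gt0//.
  exact: lt_le_trans rxT.
- move=> x y; rewrite !inE/= !in_itv/= => /andP[x0 xT] /andP[y0 yT].
  move=> /invr_inj /addrI rxy.
  have [xy|yx|//] := ltgtP x y.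
    by have := incr x y (ltW x0) xy yT; rewrite rxy ltxx.
  by have := incr y x (ltW y0) yx xT; rewrite rxy ltxx.
- move=> t /=; rewrite in_itv/= => /andP[tT t1].
  have rT := rgt0 T T0 (lexx T).
  have rT1 : 0 < 1 + r T by rewrite addr_gt0.
  have t0 : 0 < t by rewrite (lt_le_trans _ tT)// invr_gt0.
  have tV : 1 < t^-1 by rewrite invf_gt1.
  have tTV : t^-1 <= 1 + r T by rewrite -[leRHS]invrK lef_pV2// posrE invr_gt0.
  have [|c /andP[c0 cT] cE] := surj (t^-1 - 1).
    by rewrite subr_ge0 ltW// lerBlDl.
  exists c; last by rewrite cE subrKC invrK.
  (* A preimage [c] = 0 would give t^-1 <= 1, against [t] < 1. *)
  rewrite in_itv/= cT andbT lt_neqAle c0 andbT; apply: contraTneq tV => c00.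
  by rewrite -leNgt -subr_le0 -cE -c00 r0.
Qed.

(** * Growth and continuity of the noise ratio *)

Section noise_schedule.
Context {R : realType} {T : R} {alpha beta : R -> R}.
Local Notation mu := (@lebesgue_measure R).
Hypothesis alpha_int : mu.-integrable `[0, T] (EFin \o alpha).
Hypothesis beta_int : mu.-integrable `[0, T] (EFin \o beta).
Hypothesis beta_gt0 : {ae mu, forall s : R, 0 <= s <= T -> 0 < beta s}.

Let A (s : R) : R := \int[mu]_(r in `[0, s]) alpha r.
Let w (s : R) : R := expR (2 * A s) * beta s.

Let itv0S (x y : R) : x <= y -> `[0, x] `<=` `[0, y].
Proof. by move=> xy; apply: subset_itvl; rewrite bnd_simp. Qed.

Let A_cont : 0 <= T -> {within `[0, T], continuous A}.
Proof. by move=> T0; exact: parameterized_integral_continuous. Qed.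

(** The exponential factor is continuous on a compact segment, hence bounded, so [w] is dominated by
    a multiple of [beta]. *)
Let w_int (T0 : 0 <= T) : mu.-integrable `[0, T] (EFin \o w).
Proof.
have ec : {within `[0, T], continuous (fun s => expR (2 * A s))}.
  move=> x; apply: continuous_comp; last exact: continuous_expR.
  by apply: cvgM; [exact: cvg_cst|exact: A_cont].
have [M [_ bM]] : bounded_set ((fun s => expR (2 * A s)) @` `[0, T]).
  by apply: compact_bounded; apply: continuous_compact => //; exact: segment_compact.
have mb : measurable_fun `[0, T] beta.
  by apply/measurable_EFinP; exact: measurable_int beta_int.
have me : measurable_fun `[0, T] (fun s => expR (2 * A s)).
  exact: subspace_continuous_measurable_fun.
(* Only numbers strictly above [M] are known to be bounds, and [M] may be negative, hence
   [|M| + 1]. *)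
apply: (@le_integrable _ _ _ mu _ _ _ (EFin \o (fun s => (`|M| + 1) * beta s))) => //.
- by apply/measurable_EFinP; exact: measurable_funM.
- move=> x xT /=; rewrite lee_fin !normrM ler_wpM2r//.
  rewrite [leRHS]ger0_norm ?addr_ge0//.
  apply: (bM (`|M| + 1)); last by exists x.
  by rewrite (le_lt_trans (ler_norm _))// ltrDl.
- have := @integrableZl _ _ _ mu `[0, T] (measurable_itv _) (`|M| + 1) _ beta_int.
  exact: eq_integrable.
Qed.

Let B (s : R) : R := \int[mu]_(r in `[0, s]) w r.

(** Splitting the inner integral as [A tau - A s] takes exp(-2 A(tau)) out of the variance; its
    square root is [abar], which cancels. *)
Lemma noise_ratioE (tau : R) : 0 <= tau <= T ->
  noise_ratio alpha beta tau = Num.sqrt (B tau).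
Proof.
move=> /andP[tau0 tauT]; have T0 := le_trans tau0 tauT.
have w_int' : mu.-integrable `[0, tau] (EFin \o w).
  by apply: integrableS (w_int T0) => //; exact: itv0S.
rewrite /noise_ratio /sigma /abar -/(A tau).
have -> : \int[mu]_(s in `[0, tau]) (expR (- (2 * \int[mu]_(r in `[s, tau]) alpha r)) * beta s) =
    \int[mu]_(s in `[0, tau]) (expR (- (2 * A tau)) * w s).
  apply: eq_Rintegral => s; rewrite inE/= in_itv/= => /andP[s0 st].
  rewrite (Rintegral_itv0B alpha_int)// -/(A s) -/(A tau) mulrA -expRD.
  by congr (expR _ * _); ring.
rewrite RintegralZl// sqrtrM ?expR_ge0// mulrAC -[RHS]mul1r; congr (_ * _).
have -> : - (2 * A tau) = - A tau + - A tau by ring.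
by rewrite expRD -expr2 sqrtr_sqr ger0_norm ?expR_ge0// divff ?expR_eq0.
Qed.

Let B_cont (T0 : 0 <= T) : {within `[0, T], continuous B}.
Proof. apply: parameterized_integral_continuous => //; exact: w_int. Qed.

Let B0 : B 0 = 0. Proof. by rewrite /B set_itv1 Rintegral_set1. Qed.

Let B_incr (t1 t2 : R) : 0 <= t1 -> t1 < t2 -> t2 <= T -> B t1 < B t2.
Proof.
move=> t10 t12 t2T; have T0 : 0 <= T by lra.
rewrite -subr_gt0 -(Rintegral_itv0B (w_int T0) t10 (ltW t12) t2T).
apply: Rintegral_gt0 => //.
- have mE : mu `[t1, t2] = (t2 - t1)%:E by rewrite lebesgue_measure_itv/= lte_fin t12.
  by apply/eqP => /(etrans (esym mE)) /eqP; rewrite eqe subr_eq0 gt_eqF.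
- by apply: integrableS (w_int T0) => //; apply: subset_itv; rewrite bnd_simp.
(* The exponential factor is positive everywhere, so the null set for [beta] also serves for [w]. *)
- have [N [mN N0 betaN]] := beta_gt0; exists N; split => //.
  apply: subset_trans betaN => s /=; apply: contra_not => bs.
  rewrite in_itv/= => /andP[s1 s2].
  by rewrite mulr_gt0 ?expR_gt0// bs//; lra.
Qed.

Let B_ge0 (t : R) : 0 <= t <= T -> 0 <= B t.
Proof.
move=> /andP[]; rewrite le_eqVlt => /predU1P[<-|t0 tT]; first by rewrite B0.
by rewrite -B0 ltW// B_incr.
Qed.

Lemma noise_ratio0 : 0 <= T -> noise_ratio alpha beta 0 = 0.
Proof. by move=> T0; rewrite noise_ratioE ?lexx// B0 sqrtr0. Qed.

Lemma noise_ratio_incr (t1 t2 : R) : 0 <= t1 -> t1 < t2 -> t2 <= T ->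
  noise_ratio alpha beta t1 < noise_ratio alpha beta t2.
Proof.
move=> t10 t12 t2T; rewrite !noise_ratioE; try lra.
rewrite ltr_sqrt; first exact: B_incr.
by rewrite (le_lt_trans (B_ge0 _) (B_incr _ t12 _))//; lra.
Qed.

Lemma noise_ratio_gt0 (tau : R) : 0 < tau <= T -> 0 < noise_ratio alpha beta tau.
Proof.
move=> /andP[t0 tT]; rewrite -noise_ratio0; last lra.
exact: noise_ratio_incr.
Qed.

(** Intermediate value theorem for the square root of [B], continuous as an integral with variable
    endpoint. *)
Lemma noise_ratio_surj (v : R) : 0 <= T ->
  0 <= v <= noise_ratio alpha beta T ->
  exists2 c, 0 <= c <= T & noise_ratio alpha beta c = v.
Proof.
move=> T0; rewrite noise_ratioE ?T0 ?lexx// => vT.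
have rc : {within `[0, T], continuous (fun s => Num.sqrt (B s))}.
  move=> x; apply: continuous_comp; last exact: sqrt_continuous.
  exact: (B_cont T0).
have [|c] := @IVT R _ 0 T v T0 rc.
  by rewrite B0 sqrtr0 minEle maxEle sqrtr_ge0.
by rewrite in_itv/= => cT cE; exists c => //; rewrite noise_ratioE.
Qed.

Lemma flow_time_bij : 0 < T ->
  set_bij `]0, T] `[flow_time alpha beta T, 1[ (flow_time alpha beta).
Proof.
move=> T0; apply: inv1D_set_bij => //.
- exact/noise_ratio0/ltW.
- exact: noise_ratio_incr.
- by move=> v; apply: noise_ratio_surj; exact: ltW.
Qed.

End noise_schedule.

(** * Euclidean inner product on row vectors *)

Section dot_product.
Context {R : realType} {d : nat}.
Implicit Types u v h : 'rV[R]_d.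

(** The Gaussian exponent is Euclidean, whereas the norm on ['rV[R]_d] is the sup norm of the
    coordinates. *)
Definition dotv u v : R := \sum_i u 0 i * v 0 i.

Lemma dotvC u v : dotv u v = dotv v u.
Proof. by apply: eq_bigr => i _; rewrite mulrC. Qed.

Lemma dotvDr u v h : dotv u (v + h) = dotv u v + dotv u h.
Proof. by rewrite /dotv -big_split; apply: eq_bigr => i _; rewrite mxE mulrDr. Qed.

Lemma dotvDl u v h : dotv (u + v) h = dotv u h + dotv v h.
Proof. by rewrite dotvC dotvDr !(dotvC h). Qed.

Lemma dotvZr (a : R) u v : dotv u (a *: v) = a * dotv u v.
Proof. by rewrite /dotv big_distrr; apply: eq_bigr => i _; rewrite mxE mulrCA. Qed.

Lemma dotvZl (a : R) u v : dotv (a *: u) v = a * dotv u v.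
Proof. by rewrite dotvC dotvZr dotvC. Qed.

Fact dotv_is_linear u : linear (dotv u).
Proof. by move=> a v h; rewrite dotvDr dotvZr. Qed.

HB.instance Definition _ u :=
  GRing.isLinear.Build R 'rV[R]_d R *%R (dotv u) (dotv_is_linear u).

Lemma dotv_delta u i : dotv u (delta_mx 0 i) = u 0 i.
Proof.
rewrite /dotv (bigD1 i)//= mxE !eqxx mulr1 big1 ?addr0// => j ji.
by rewrite mxE (negbTE ji) andbF mulr0.
Qed.

Lemma dotvv_ge0 u : 0 <= dotv u u.
Proof. by apply: sumr_ge0 => i _; rewrite -expr2 sqr_ge0. Qed.

(** For [v] nonzero, expand the nonnegative square of |v|^2 u - <u,v> v, which equals |v|^2 (|u|^2
    |v|^2 - <u,v>^2). *)
Lemma dotv_CauchySchwarz u v : dotv u v ^+ 2 <= dotv u u * dotv v v.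
Proof.
have [v0|v0] := eqVneq (dotv v v) 0.
  have vi i : v 0 i = 0.
    have : dotv v v <= 0 by rewrite v0.
    rewrite /dotv (bigD1 i)//= -expr2 => vi0.
    have s0 : 0 <= \sum_(j | j != i) v 0 j * v 0 j.
      by apply: sumr_ge0 => j _; rewrite -expr2 sqr_ge0.
    by apply/eqP; rewrite -sqrf_eq0 eq_le sqr_ge0 andbT; lra.
  by rewrite v0 mulr0 /dotv big1 ?expr0n// => i _; rewrite vi mulr0.
have vv : 0 < dotv v v by rewrite lt_neqAle eq_sym v0 dotvv_ge0.
have := dotvv_ge0 (dotv v v *: u + - dotv u v *: v).
suff -> : dotv (dotv v v *: u + - dotv u v *: v) (dotv v v *: u + - dotv u v *: v) =
    dotv v v * (dotv u u * dotv v v - dotv u v ^+ 2).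
  by rewrite pmulr_rge0// subr_ge0.
by rewrite !(dotvDl, dotvDr, dotvZl, dotvZr) (dotvC v u); ring.
Qed.

Lemma coord_le_norm u i : `|u 0 i| <= `|u|.
Proof. by rewrite [`|u|]mx_normrE; exact: (le_bigmax _ _ (0, i)). Qed.

(** Each of the [d] squared coordinates is at most the squared sup norm. *)
Lemma dotvv_le_norm u : dotv u u <= d%:R * `|u| ^+ 2.
Proof.
rewrite mulr_natl -[X in _ *+ X]card_ord -sumr_const; apply: ler_sum => i _.
by rewrite -expr2 -real_normK ?num_real// lerXn2r ?nnegrE//; exact: coord_le_norm.
Qed.

Lemma dotv_continuous u : continuous (dotv u).
Proof.
rewrite /dotv; apply: continuous_big => [|i _].
  by move=> x; apply: cvgD; [exact: cvg_fst|exact: cvg_snd].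
by move=> x; apply: continuousM; [exact: cst_continuous|exact: coord_continuous].
Qed.

Lemma dotvv_continuous : continuous (fun u => dotv u u).
Proof.
rewrite /dotv; apply: continuous_big => [|i _].
  by move=> x; apply: cvgD; [exact: cvg_fst|exact: cvg_snd].
move=> x; have ci := @coord_continuous R 1 d 0 i x.
exact: (continuousM ci ci).
Qed.

End dot_product.

(** * Taylor remainders of the exponential and of the Gaussian kernel *)

(** From (1 - w) e^w <= 1 the remainder is at most w (e^w - 1), which is at most w^2 e^w for [w] >=
    0 and at most w^2 for [w] < 0; the sum covers both signs. *)
Lemma expR_quadratic_remainder (R : realType) (w : R) :
  0 <= expR w - 1 - w <= w ^+ 2 * (1 + expR w).
Proof.
have e1 := expR_ge1Dx w; have e2 := expR_ge1Dx (- w).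
have ew := expR_gt0 w.
have : (1 - w) * expR w <= 1.
  by have := ler_wpM2r (ltW ew) e2; rewrite -expRD addNr expR0.
move=> e3; apply/andP; split; first lra.
have [w0|w0] := leP 0 w; nra.
Qed.

(** Lets the decay of the Gaussian absorb a factor quadratic in its argument. *)
Lemma mul_expRN_le1 (R : realType) (x : R) : x * expR (- x) <= 1.
Proof. by rewrite expRN ler_pdivrMr ?expR_gt0// mul1r; have := expR_ge1Dx x; lra. Qed.

Section gaussian_kernel.
Context {R : realType} {d : nat}.
Variable kap : R.
Hypothesis kap_gt0 : 0 < kap.
Implicit Types u h : 'rV[R]_d.

(** An unnormalised centred Gaussian; [kap] stands for 1 / (2 variance). *)
Definition gkernel u : R := expR (- (kap * dotv u u)).

Lemma gkernel_gt0 u : 0 < gkernel u. Proof. exact: expR_gt0. Qed.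

Lemma gkernel_le1 u : gkernel u <= 1.
Proof. by rewrite /gkernel -expR0 ler_expR oppr_le0 mulr_ge0 ?dotvv_ge0// ltW. Qed.

Lemma gkernel_continuous : continuous gkernel.
Proof.
move=> u; apply: (@continuous_comp _ _ _ (fun v => - (kap * dotv v v)) expR).
  apply: continuousN; apply: (@continuousM _ _ (cst kap) (fun v => dotv v v)).
    exact: cst_continuous.
  exact: dotvv_continuous.
exact: continuous_expR.
Qed.

(** Bound |u_i| by 1 + |u|^2; the kernel is at most 1 and its product with |u|^2 at most 1 / kap. *)
Lemma coord_gkernel_bounded u i : `|u 0 i * gkernel u| <= 1 + kap^-1.
Proof.
have ek := mul_expRN_le1 (kap * dotv u u); rewrite -/(gkernel u) in ek.
have k0 := gkernel_gt0 u; have k1 := gkernel_le1 u.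
rewrite normrM (gtr0_norm k0).
have ui : `|u 0 i| ^+ 2 <= dotv u u.
  rewrite real_normK ?num_real// /dotv (bigD1 i)//= -expr2 lerDl.
  by apply: sumr_ge0 => j _; rewrite -expr2 sqr_ge0.
have ui1 : `|u 0 i| <= 1 + dotv u u by nra.
have uk : dotv u u * gkernel u <= kap^-1.
  by rewrite -[leRHS]mul1r ler_pdivlMr// mulrC mulrA.
nra.
Qed.

(* With w the exponent increment, the remainder of expR costs w^2 k(u) +
   w^2 k(u + h); writing w in terms of u in the first term and of u + h in the
   second lets the decay of the kernel at that same point absorb w^2. *)
Lemma gkernel_quadratic_remainder u h :
  `|gkernel (u + h) - gkernel u + 2 * kap * dotv u h * gkernel u| <=
  kap * dotv h h * (17 + 4 * (kap * dotv h h)).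
Proof.
have cs1 := dotv_CauchySchwarz u h; have cs2 := dotv_CauchySchwarz (u + h) h.
have ek1 := mul_expRN_le1 (kap * dotv u u); rewrite -/(gkernel u) in ek1.
have ek2 := mul_expRN_le1 (kap * dotv (u + h) (u + h)).
rewrite -/(gkernel (u + h)) in ek2.
have k10 := gkernel_gt0 u; have k11 := gkernel_le1 u.
have k20 := gkernel_gt0 (u + h); have k21 := gkernel_le1 (u + h).
have uu := dotvv_ge0 u; have vv := dotvv_ge0 (u + h); have qq := dotvv_ge0 h.
pose w := - (kap * (2 * dotv u h + dotv h h)).
have kE : gkernel (u + h) = gkernel u * expR w.
  rewrite /gkernel -expRD; congr expR.
  by rewrite /w !(dotvDl, dotvDr) (dotvC h u); ring.
have /andP[r0 r1] := expR_quadratic_remainder w.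
(* By (p + q)^2 <= 2 p^2 + 2 q^2 with p = 2 <u,h> and q = |h|^2, then Cauchy-Schwarz on <u,h>^2;
   hence 8 and 2. *)
have w1 : w ^+ 2 <= kap * dotv h h * (8 * (kap * dotv u u) + 2 * (kap * dotv h h)).
  have -> : kap * dotv h h * (8 * (kap * dotv u u) + 2 * (kap * dotv h h)) =
    kap ^+ 2 * (8 * (dotv u u * dotv h h) + 2 * dotv h h ^+ 2) by ring.
  rewrite /w sqrrN exprMn ler_pM2l ?exprn_gt0//.
  have := sqr_ge0 (2 * dotv u h - dotv h h); nra.
have w2 : w ^+ 2 <=
    kap * dotv h h * (8 * (kap * dotv (u + h) (u + h)) + 2 * (kap * dotv h h)).
  have -> : kap * dotv h h * (8 * (kap * dotv (u + h) (u + h)) + 2 * (kap * dotv h h)) =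
    kap ^+ 2 * (8 * (dotv (u + h) (u + h) * dotv h h) + 2 * dotv h h ^+ 2) by ring.
  rewrite /w sqrrN exprMn ler_pM2l ?exprn_gt0//.
  (* Recentring at [u + h] only flips the sign of |h|^2, so the same estimate applies there. *)
  have -> : 2 * dotv u h + dotv h h = 2 * dotv (u + h) h - dotv h h.
    by rewrite dotvDl; ring.
  have := sqr_ge0 (2 * dotv (u + h) h + dotv h h); nra.
have kq0 : 0 <= kap * dotv h h by rewrite mulr_ge0// ltW.
(* The first-order part of [w] cancels the linear term and leaves only its |h|^2 part. *)
have -> : gkernel (u + h) - gkernel u + 2 * kap * dotv u h * gkernel u =
  gkernel u * (expR w - 1 - w) - gkernel u * (kap * dotv h h).
  by rewrite kE /w; ring.
have b1 : w ^+ 2 * gkernel u <= kap * dotv h h * (8 + 2 * (kap * dotv h h)).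
  apply: le_trans (ler_wpM2r (ltW k10) w1) _.
  by rewrite -[leLHS]mulrA ler_wpM2l//; nra.
have b2 : w ^+ 2 * gkernel (u + h) <= kap * dotv h h * (8 + 2 * (kap * dotv h h)).
  apply: le_trans (ler_wpM2r (ltW k20) w2) _.
  by rewrite -[leLHS]mulrA ler_wpM2l//; nra.
have b3 : gkernel u * (expR w - 1 - w) <= w ^+ 2 * gkernel u + w ^+ 2 * gkernel (u + h).
  apply: le_trans (ler_wpM2l (ltW k10) r1) _.
  by rewrite kE le_eqVlt; apply/orP; left; apply/eqP; ring.
have b4 : 0 <= gkernel u * (expR w - 1 - w) by rewrite mulr_ge0// ltW.
have b5 : 0 <= gkernel u * (kap * dotv h h) <= kap * dotv h h.
  by rewrite mulr_ge0 ?(ltW k10)// ler_piMl.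
(* [b1] and [b2] each contribute 8 and 2, and [b5] contributes 1: 17 = 8 + 8 + 1 and 4 = 2 + 2. *)
by rewrite ler_norml; apply/andP; split; lra.
Qed.

End gaussian_kernel.

(** * Differentiability from a quadratic remainder *)

(** A quadratic remainder is o(h), and uniqueness of the differential identifies it with [L].
    Restricting to |h| <= 1 allows remainders with higher-order terms. *)
Lemma quadratic_remainder_is_diff (R : realType) (V : normedModType R)
    (f : V -> R) (L : {linear V -> R}) (x : V) (C : R) :
  continuous L ->
  (forall h, `|h| <= 1 -> `|f (x + h) - f x - L h| <= C * `|h| ^+ 2) ->
  is_diff x f L.
Proof.
move=> cL fL.
have fE : f \o shift x = cst (f x) + L +o_ (0 : V) id.
  apply/eqaddoP => _/posnumP[e]; near=> h.
  have h1 : `|h| <= 1.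
    near: h; apply/nbhs_normP; exists 1 => //= h /=.
    by rewrite sub0r normrN => /ltW.
  (* [|C| + 1] dominates [C] and is positive, so dividing by it is safe. *)
  have he : (`|C| + 1) * `|h| <= e%:num.
    near: h; apply/nbhs_normP; exists (e%:num / (`|C| + 1)) => /=.
      by rewrite divr_gt0// ltr_wpDl.
    move=> h /=; rewrite sub0r normrN ltr_pdivlMr ?ltr_wpDl// => /ltW.
    by rewrite mulrC.
  rewrite /= [X in `|X|](_ : _ = f (x + h) - f x - L h); last first.
    by rewrite -[in RHS]addrA -opprD [x + h]addrC.
  apply: le_trans (fL h h1) _; rewrite expr2 mulrA ler_wpM2r//.
  by apply: le_trans he; rewrite ler_wpM2r// (le_trans (ler_norm _))// lerDl.
have dE := diff_unique cL fE.
by apply: DiffDef => //; apply/diff_locallyP; rewrite dE.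
Unshelve. all: by end_near. Qed.

(** * Integration against a Borel probability on row vectors *)

Section borel_rV_integral.
Context {R : realType} {d : nat} (P : probability (borel_rV R d) R).

(** It suffices to test open intervals, whose preimages are open and so generate [borel_rV]'s
    measurable sets. *)
Lemma borel_rV_measurable_fun (f : 'rV[R]_d -> R) :
  continuous f -> measurable_fun setT (f : borel_rV R d -> R).
Proof.
move=> /continuousP cf; apply: (measurability _ (RGenOpens.measurableE R)).
move=> _ [_ [a [b ->] <-]]; rewrite setTI; apply: sub_sigma_algebra.
exact/cf/interval_open.
Qed.

Lemma borel_rV_bounded_integrable (f : 'rV[R]_d -> R) (M : R) :
  continuous f -> (forall z, `|f z| <= M) ->
  P.-integrable [set: borel_rV R d] (EFin \o f).
Proof.
move=> cf fM; apply: measurable_bounded_integrable => //.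
- by apply: le_lt_trans (probability_le1 P measurableT) _; exact: ltry.
- exact: borel_rV_measurable_fun.
- exists M; split; first exact: num_real.
  by move=> x Mx y _ /=; exact: le_trans (fM y) (ltW Mx).
Qed.

Lemma Rintegral_dotv (v : 'rV[R]_d) (F : borel_rV R d -> 'rV[R]_d) :
  (forall i, P.-integrable [set: borel_rV R d] (fun z => (F z 0 i)%:E)) ->
  \int[P]_(z in [set: borel_rV R d]) dotv v (F z) =
  dotv v (\row_i \int[P]_(z in [set: borel_rV R d]) F z 0 i).
Proof.
move=> Fi; rewrite /Rintegral /dotv.
under eq_integral do rewrite -sumEFin.
rewrite integral_sum//; last first.
  move=> i; under eq_fun do rewrite EFinM; exact: integrableZl.
rewrite -sum_fine//; last first.
  move=> i _; rewrite integrable_fin_num//.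
  under eq_fun do rewrite EFinM; exact: integrableZl.
apply: eq_bigr => i _; rewrite mxE -[RHS]RintegralZl//; exact: Fi.
Qed.

Lemma Rintegral_prob_gt0 (f : 'rV[R]_d -> R) :
  P.-integrable [set: borel_rV R d] (EFin \o f) -> (forall z, 0 < f z) ->
  0 < \int[P]_(z in [set: borel_rV R d]) f z.
Proof.
move=> fint f0; apply: Rintegral_gt0 => //.
- apply/eqP => PT0; have /eqP := etrans (esym PT0) (probability_setT P).
  by rewrite eqe eq_sym oner_eq0.
- by apply: aeW => z _.
Qed.

End borel_rV_integral.

(** * Differentiation of a Gaussian mixture *)

Section gaussian_mixture.
Context {R : realType} {d : nat} (P : probability (borel_rV R d) R).
Variables kap a : R.
Hypothesis kap_gt0 : 0 < kap.
Implicit Types y h : 'rV[R]_d.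
Local Notation PT := [set: borel_rV R d].

Definition mixture y : R :=
  \int[P]_(z in PT) gkernel kap (y - a *: (z : 'rV[R]_d)).

(** Divided by [mixture y], this is the posterior mean of y - a z. *)
Definition mixture_moment y : 'rV[R]_d :=
  \row_i \int[P]_(z in PT)
    ((y - a *: (z : 'rV[R]_d)) 0 i * gkernel kap (y - a *: (z : 'rV[R]_d))).

Let shift_continuous (g : 'rV[R]_d -> R) y :
  continuous g -> continuous (fun z : 'rV[R]_d => g (y - a *: z)).
Proof.
move=> cg z; apply: (@continuous_comp _ _ _ (fun v : 'rV[R]_d => y - a *: v) g).
  apply: (@continuousB _ _ _ (cst y) (fun v : 'rV[R]_d => a *: v)).
    exact: cst_continuous.
  exact: scaler_continuous.
exact: cg.
Qed.

Lemma mixture_integrable y :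
  P.-integrable PT (EFin \o (fun z => gkernel kap (y - a *: (z : 'rV[R]_d)))).
Proof.
apply: (@borel_rV_bounded_integrable _ _ _ (fun z => gkernel kap (y - a *: z)) 1).
  exact/shift_continuous/gkernel_continuous.
by move=> z; rewrite gtr0_norm ?gkernel_gt0// gkernel_le1.
Qed.

Lemma mixture_moment_integrable y i :
  P.-integrable PT (EFin \o (fun z =>
    (y - a *: (z : 'rV[R]_d)) 0 i * gkernel kap (y - a *: (z : 'rV[R]_d)))).
Proof.
apply: (@borel_rV_bounded_integrable _ _ _
  (fun z => (y - a *: z) 0 i * gkernel kap (y - a *: z)) (1 + kap^-1)).
  apply: (@shift_continuous (fun u => u 0 i * gkernel kap u)) => u.
  apply: (@continuousM _ _ (fun v : 'rV[R]_d => v 0 i) (gkernel kap)).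
    exact: coord_continuous.
  exact: gkernel_continuous.
by move=> z; exact: coord_gkernel_bounded.
Qed.

Lemma mixture_gt0 y : 0 < mixture y.
Proof.
apply: Rintegral_prob_gt0; first exact: mixture_integrable.
by move=> z; exact: gkernel_gt0.
Qed.

(** The kernel remainder bound is independent of [z], so integrating it against a measure of total
    mass 1 preserves it. *)
Lemma mixture_quadratic_remainder y h :
  `|mixture (y + h) - mixture y - dotv (- (2 * kap) *: mixture_moment y) h| <=
  kap * dotv h h * (17 + 4 * (kap * dotv h h)).
Proof.
pose u (z : borel_rV R d) : 'rV[R]_d := y - a *: (z : 'rV[R]_d).
have i1 := mixture_integrable (y + h).
have i2 := mixture_integrable y.
have i3 i := mixture_moment_integrable y i.
have i4 : P.-integrable PT (EFin \o (fun z => dotv h (gkernel kap (u z) *: u z))).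
  have -> : EFin \o (fun z => dotv h (gkernel kap (u z) *: u z)) =
      (fun z => (\sum_i ((h 0%R i)%:E * (u z 0%R i * gkernel kap (u z))%:E))%E).
    apply/funext => z /=; rewrite /dotv -sumEFin; apply: eq_bigr => i _.
    by rewrite -EFinM mxE [u z 0 i * _]mulrC.
  apply: integrable_sum => // i _.
  exact: (@integrableZl _ _ _ P PT measurableT (h 0 i) _ (i3 i)).
have i5 : P.-integrable PT (EFin \o (fun z => gkernel kap (u z + h))).
  by move: i1; congr (P.-integrable _ _); apply/funext => z /=; rewrite addrAC.
have i6 : P.-integrable PT
    (EFin \o (fun z => 2 * kap * dotv h (gkernel kap (u z) *: u z))).
  exact: (@integrableZl _ _ _ P PT measurableT (2 * kap) _ i4).
have i7 : P.-integrable PT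
    (EFin \o (fun z => gkernel kap (u z + h) - gkernel kap (u z))).
  exact: (integrableB measurableT i5 i2).
have i8 : P.-integrable PT (EFin \o (fun z => gkernel kap (u z + h) -
    gkernel kap (u z) + 2 * kap * dotv h (gkernel kap (u z) *: u z))).
  exact: (integrableD measurableT i7 i6).
have dE : dotv (- (2 * kap) *: mixture_moment y) h =
    - (2 * kap) * \int[P]_(z in PT) dotv h (gkernel kap (u z) *: u z).
  rewrite Rintegral_dotv; last first.
    move=> i; have := i3 i; apply: eq_integrable => // z _ /=.
    by rewrite [in RHS]mxE mulrC.
  rewrite dotvZl [in LHS]dotvC; congr (_ * dotv _ _); apply/rowP => i.
  by rewrite !mxE; apply: eq_Rintegral => z _; rewrite [in RHS]mxE mulrC.
have mE : mixture (y + h) = \int[P]_(z in PT) gkernel kap (u z + h).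
  by apply: eq_Rintegral => z _; rewrite /u addrAC.
have -> : mixture (y + h) - mixture y - dotv (- (2 * kap) *: mixture_moment y) h =
  \int[P]_(z in PT) (gkernel kap (u z + h) - gkernel kap (u z) +
     2 * kap * dotv h (gkernel kap (u z) *: u z)).
  rewrite (RintegralD measurableT i7 i6) (RintegralB measurableT i5 i2).
  by rewrite (RintegralZl _ measurableT i4) dE mE mulNr opprK.
have bnd z : `|gkernel kap (u z + h) - gkernel kap (u z) +
     2 * kap * dotv h (gkernel kap (u z) *: u z)| <=
     kap * dotv h h * (17 + 4 * (kap * dotv h h)).
  have -> : 2 * kap * dotv h (gkernel kap (u z) *: u z) =
      2 * kap * dotv (u z) h * gkernel kap (u z).
    by rewrite dotvZr (dotvC h); ring.
  exact: gkernel_quadratic_remainder.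
apply: (le_trans (le_normr_Rintegral measurableT i8)).
have {i1 i2 i3 i4 i5 i6 i7} i9 := integrable_norm i8.
apply: (@le_trans _ _
    (\int[P]_(z in PT) (kap * dotv h h * (17 + 4 * (kap * dotv h h))))).
  apply: (le_Rintegral measurableT i9); first exact: finite_measure_integrable_cst.
  by move=> z _; exact: bnd.
by rewrite Rintegral_cst// [X in fine X]probability_setT mulr1.
Qed.

Lemma mixture_is_diff y :
  is_diff y mixture (dotv (- (2 * kap) *: mixture_moment y)).
Proof.
apply: (@quadratic_remainder_is_diff _ _ _ _ _
  (kap * d%:R * (17 + 4 * (kap * d%:R)))).
  exact: dotv_continuous.
move=> h h1; apply: le_trans (mixture_quadratic_remainder y h) _.
pose Q := kap * dotv h h.
have Qh : Q <= kap * d%:R * `|h| ^+ 2.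
  by rewrite -mulrA ler_pM2l//; exact: dotvv_le_norm.
have Q0 : 0 <= Q by rewrite mulr_ge0 ?dotvv_ge0// ltW.
(* For |h| <= 1 this turns the factor 17 + 4 Q into a constant, leaving a bound quadratic in [h]. *)
have Qd : Q <= kap * d%:R.
  apply: le_trans Qh _; rewrite ler_piMr ?exprn_ile1//.
  by rewrite mulr_ge0// ltW.
by rewrite -/Q [leRHS]mulrAC ler_pM//; lra.
Qed.

End gaussian_mixture.

(** * Differential of the logarithm and Gaussian normalisation *)

Lemma diff_ln (R : realType) (p h : R) : 0 < p ->
  differentiable (@ln R) p /\ 'd (@ln R) p h = h / p.
Proof.
move=> p0; have dln := is_derive1_ln p0.
have dl : differentiable (@ln R) p by apply/derivable1_diffP.
split=> //; rewrite -[in LHS](mulr1 h) -[h * 1]/(h *: (1 : R)) linearZ/=.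
by rewrite -deriveE// derive_val.
Qed.

Section gaussian_pdf.
Context {R : realType} {d : nat}.

Definition gaussian_cst (v : R) : R := (Num.sqrt ((2 * pi) ^+ d * v ^+ d))^-1.

Lemma gaussian_cst_gt0 v : 0 < v -> 0 < gaussian_cst v.
Proof.
by move=> v0; rewrite invr_gt0 sqrtr_gt0 mulr_gt0 ?exprn_gt0// mulr_gt0 ?pi_gt0.
Qed.

Lemma mvnormal_pdf_scalar (m y : 'rV[R]_d) (v : R) :
  mvnormal_pdf m v%:M y = gaussian_cst v * gkernel (2 * v)^-1 (y - m).
Proof.
rewrite /mvnormal_pdf det_scalar; congr (_ * expR (- _)).
have uu (u : 'rV[R]_d) : (u *m u^T) 0 0 = dotv u u.
  by rewrite mxE; apply: eq_bigr => i _; rewrite mxE.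
by rewrite invmx_scalar mul_mx_scalar -scalemxAl mxE uu invfM; ring.
Qed.

End gaussian_pdf.

(** * The velocity in terms of the posterior mean *)

Section score_velocity.
Context {R : realType} {d : nat} (P : probability (borel_rV R d) R).
Variables a s : R.
Hypotheses (a_gt0 : 0 < a) (s_gt0 : 0 < s).
Local Notation PT := [set: borel_rV R d].
Let kap := (2 * s ^+ 2)^-1.
Let t := (1 + s / a)^-1.
Let cst2 v := @gaussian_cst R d v.

Let kap_gt0 : 0 < kap. Proof. by rewrite invr_gt0 mulr_gt0 ?exprn_gt0. Qed.

Let tE : t = a / (a + s).
Proof. by rewrite /t; field; rewrite !gt_eqF// addr_gt0. Qed.

Let tNE : 1 - t = s / (a + s).
Proof. by rewrite tE; field; rewrite gt_eqF// addr_gt0. Qed.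

Let tN_gt0 : 0 < 1 - t. Proof. by rewrite tNE divr_gt0// addr_gt0. Qed.

(** Scaling x - t z by a + s gives (a + s) x - a z and turns the standard deviation 1 - t = s / (a +
    s) into [s]. *)
Let normal_pdfE (x z : 'rV[R]_d) :
  mvnormal_pdf (t *: z) ((1 - t) ^+ 2)%:M x =
  cst2 ((1 - t) ^+ 2) * gkernel kap ((a + s) *: x - a *: z).
Proof.
rewrite mvnormal_pdf_scalar; congr (_ * expR (- _)).
have -> : (a + s) *: x - a *: z = (a + s) *: (x - t *: z).
  by rewrite scalerBr scalerA tE mulrCA divff ?mulr1// gt_eqF// addr_gt0.
rewrite dotvZl dotvZr tNE /kap; field.
by rewrite !gt_eqF// addr_gt0.
Qed.

Let flow_pdfE x : flow_pdf P t x =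
  cst2 ((1 - t) ^+ 2) * mixture P kap a ((a + s) *: x).
Proof.
rewrite /flow_pdf /mixture -RintegralZl//; last exact: mixture_integrable.
by apply: eq_Rintegral => z _; exact: normal_pdfE.
Qed.

Lemma flow_pdf_gt0 x : 0 < flow_pdf P t x.
Proof. by rewrite flow_pdfE mulr_gt0 ?mixture_gt0// gaussian_cst_gt0 ?exprn_gt0. Qed.

Let Y (x : 'rV[R]_d) : 'rV[R]_d := (a + s) *: x.
Let u x (z : borel_rV R d) : 'rV[R]_d := Y x - a *: (z : 'rV[R]_d).
Let b x : R := (a + s) / (a * s * mixture P kap a (Y x)).

(** The displacement is (z - x) / (1 - t) = (a + s) / (a s) (s x - u), affine in [u]; [b] is this
    factor divided by the mixture, and the normalising constants cancel. *)
Let velocity_integrandE x i : velocity_integrand P t x i =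
  fun z => b x * s * x 0 i * gkernel kap (u x z) -
           b x * (u x z 0 i * gkernel kap (u x z)).
Proof.
apply/funext => z.
rewrite /velocity_integrand /flow_posterior normal_pdfE flow_pdfE.
rewrite -/(Y x) -/(u x z) /flow_displacement tNE.
have c0 : cst2 ((1 - t) ^+ 2) != 0.
  by rewrite gt_eqF// gaussian_cst_gt0// exprn_gt0.
have m0 : mixture P kap a (Y x) != 0 by rewrite gt_eqF// mixture_gt0.
have -> : cst2 ((s / (a + s)) ^+ 2) = cst2 ((1 - t) ^+ 2) by rewrite tNE.
have ui : u x z 0 i = (a + s) * x 0 i - a * (z : 'rV[R]_d) 0 i by rewrite !mxE.
rewrite ui !mxE /b; set c := cst2 _ in c0 *; set K := mixture _ _ _ _ in m0 *.
rewrite tE; set g := gkernel _ _; field.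
by rewrite c0 m0 !gt_eqF// addr_gt0.
Qed.

Let b_gkernel_integrable x i : P.-integrable PT
  (EFin \o (fun z => b x * s * x 0 i * gkernel kap (u x z))).
Proof.
have := mixture_integrable P a kap_gt0 (Y x).
exact: (@integrableZl _ _ _ P PT measurableT (b x * s * x 0 i)).
Qed.

Let b_coord_gkernel_integrable x i : P.-integrable PT
  (EFin \o (fun z => b x * (u x z 0 i * gkernel kap (u x z)))).
Proof.
have := mixture_moment_integrable P a kap_gt0 (Y x) i.
exact: (@integrableZl _ _ _ P PT measurableT (b x)).
Qed.

Lemma velocity_integrand_integrable x i :
  P.-integrable PT (EFin \o velocity_integrand P t x i).
Proof.
rewrite velocity_integrandE.
exact: (integrableB measurableT (b_gkernel_integrable x i)
  (b_coord_gkernel_integrable x i)).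
Qed.

(** Integrating the affine form gives (s x - m) / a with m the posterior mean of y - a z at y = (a +
    s) x. *)
Lemma velocityE x : (1 - t) *: velocity P x t =
  a^-1 *: (s *: x - (mixture P kap a ((a + s) *: x))^-1 *:
                     mixture_moment P kap a ((a + s) *: x)).
Proof.
apply/rowP => i; rewrite !mxE velocity_integrandE.
have i1 := mixture_integrable P a kap_gt0 (Y x).
have i2 := mixture_moment_integrable P a kap_gt0 (Y x) i.
rewrite RintegralB// !RintegralZl// -/(mixture P kap a (Y x)).
have m0 : mixture P kap a (Y x) != 0 by rewrite gt_eqF// mixture_gt0.
rewrite tNE /b -/(Y x); set K := mixture _ _ _ _ in m0 *.
rewrite /u; set M := Rintegral _ _ _; field.
by rewrite m0 !gt_eqF// addr_gt0.
Qed.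

End score_velocity.

(** * The score in terms of the posterior mean *)

Section score.
Context {R : realType} {d : nat} (P : probability (borel_rV R d) R).
Variables (alpha beta : R -> R) (tau : R).
Local Notation a := (abar alpha tau).
Local Notation s := (sigma alpha beta tau).
Hypothesis s_gt0 : 0 < s.
Let kap := (2 * s ^+ 2)^-1.

Let kap_gt0 : 0 < kap. Proof. by rewrite invr_gt0 mulr_gt0 ?exprn_gt0. Qed.

Lemma diffusion_pdfE :
  diffusion_pdf alpha beta P tau = @gaussian_cst R d (s ^+ 2) *: mixture P kap a.
Proof.
apply/funext => y.
rewrite -[RHS]/(_ * mixture P kap a y) -RintegralZl//.
  by apply: eq_Rintegral => z _; exact: mvnormal_pdf_scalar.
exact: mixture_integrable.
Qed.

Lemma diffusion_pdf_gt0 y : 0 < diffusion_pdf alpha beta P tau y.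
Proof.
rewrite diffusion_pdfE -[ltRHS]/(_ * mixture P kap a y) mulr_gt0 ?mixture_gt0//.
by rewrite gaussian_cst_gt0 ?exprn_gt0.
Qed.

Let diffusion_pdf_is_diff y : is_diff y (diffusion_pdf alpha beta P tau)
  (@gaussian_cst R d (s ^+ 2) *: dotv (- (2 * kap) *: mixture_moment P kap a y)).
Proof. by rewrite diffusion_pdfE; apply: is_diffZ; exact: mixture_is_diff. Qed.

Lemma log_diffusion_pdf_differentiable y :
  differentiable (log_diffusion_pdf alpha beta P tau) y.
Proof.
apply: (@differentiable_comp _ _ _ _ (diffusion_pdf alpha beta P tau) (@ln R)).
  by have [] := diffusion_pdf_is_diff y.
by have [] := diff_ln 0 (diffusion_pdf_gt0 y).
Qed.

(** Tweedie's formula: the logarithmic derivative cancels the normalising constant, and 2 kap = 1 /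
    s^2 leaves -m / s^2 with m the posterior mean of y - a z. *)
Lemma scoreE y : score alpha beta P tau y =
  - (s ^+ 2 * mixture P kap a y)^-1 *: mixture_moment P kap a y.
Proof.
apply/rowP => i; rewrite mxE deriveE; last exact: log_diffusion_pdf_differentiable.
have [df dfE] := diffusion_pdf_is_diff y.
have [dl _] := diff_ln 0 (diffusion_pdf_gt0 y).
rewrite (@diff_comp _ _ _ _ (diffusion_pdf alpha beta P tau) (@ln R))//=.
have [_ ->] := diff_ln ('d (diffusion_pdf alpha beta P tau) y (delta_mx 0 i))
  (diffusion_pdf_gt0 y).
rewrite dfE diffusion_pdfE.
rewrite -[X in X / _]/(_ * dotv _ _) -[X in _ / X]/(_ * mixture P kap a y).
rewrite dotv_delta [in LHS]mxE [in RHS]mxE /kap.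
have m0 : mixture P kap a y != 0 by rewrite gt_eqF// mixture_gt0.
have c0 : @gaussian_cst R d (s ^+ 2) != 0.
  by rewrite gt_eqF// gaussian_cst_gt0 ?exprn_gt0.
set c := gaussian_cst _ in c0 *; set K := mixture _ _ _ _ in m0 *.
by field; rewrite c0 m0 gt_eqF.
Qed.

End score.

(** * Matching the velocity with the score *)

Theorem theorem1 (R : realType) (d : nat) (T : R) (alpha beta : R -> R)
    (p0 q1 : probability (borel_rV R d) R)
    (T_gt0 : 0 < T)
    (alpha_int :
      (@lebesgue_measure R).-integrable `[0, T] (EFin \o alpha))
    (beta_int :
      (@lebesgue_measure R).-integrable `[0, T] (EFin \o beta))
    (beta_gt0 :
      {ae @lebesgue_measure R, forall s : R, 0 <= s <= T -> 0 < beta s})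
    (same_target : q1 = p0) :
  (forall (tau : R) (x : 'rV[R]_d), 0 < tau <= T ->
     let a := abar alpha tau in
     let s := sigma alpha beta tau in
     let t := flow_time alpha beta tau in
     let y := (a + s) *: x in
     (* the conditional expectation and the score are well defined *)
     [/\ 0 < flow_pdf q1 t x,
         forall i : 'I_d,
           q1.-integrable [set: borel_rV R d]
             (EFin \o velocity_integrand q1 t x i),
         0 < diffusion_pdf alpha beta p0 tau y,
         differentiable (log_diffusion_pdf alpha beta p0 tau) y &
         (1 - t) *: velocity q1 x t =
           (s / a) *: (x + s *: score alpha beta p0 tau y)]) /\
  (forall tau1 tau2 : R, 0 <= tau1 -> tau1 < tau2 -> tau2 <= T ->
     noise_ratio alpha beta tau1 < noise_ratio alpha beta tau2) /\
  set_bij `]0, T] `[flow_time alpha beta T, 1[ (flow_time alpha beta).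
Proof.
split; last first.
  by split; [exact: noise_ratio_incr|exact: flow_time_bij].
rewrite same_target => tau x tauT a s t y.
have a0 : 0 < a by exact: expR_gt0.
(* Positivity of the ratio passes to its numerator, [abar] being an exponential. *)
have s0 : 0 < s.
  have := noise_ratio_gt0 alpha_int beta_int beta_gt0 tauT.
  by rewrite /noise_ratio pmulr_lgt0// invr_gt0.
split.
- exact: flow_pdf_gt0.
- by move=> i; exact: velocity_integrand_integrable.
- exact: diffusion_pdf_gt0.
- exact: log_diffusion_pdf_differentiable.
rewrite velocityE// scoreE//.
(* Both sides are now (s x - m) / a with the same posterior mean m. *)
apply/rowP => i; rewrite !mxE -/a -/s.
have m0 : mixture p0 (2 * s ^+ 2)^-1 a y != 0.
  by rewrite gt_eqF// mixture_gt0// invr_gt0 mulr_gt0 ?exprn_gt0.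
set K := mixture _ _ _ _ in m0 *; field.
by rewrite m0 !gt_eqF.
Qed.
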